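(* Consider $n$ agents $\mathcal{V}=\{1,\dots,n\}$ with Lagrangian dynamics $M_i(q_i)\ddot q_i+C_i(q_i,\dot q_i)\dot q_i=\tau_i$, $q_i\in\mathbb{R}^m$, with $M_i(q_i)$ symmetric positive definite. Let $\mathcal{X}_1,\dots,\mathcal{X}_n\subseteq\mathbb{R}^m$ be closed convex sets with $\mathcal{X}_0=\bigcap_{i}\mathcal{X}_i$ nonempty and bounded. Let $\sigma:[t_0,\infty)\to\mathcal{P}$ be a piecewise constant switching signal taking values in a finite set $\mathcal{P}$ of undirected graphs on $\mathcal{V}$, with switching times $t_0<t_1<\dots$ satisfying $\inf_l(t_{l+1}-t_l)\ge\tau_d>0$; let $\mathcal{N}_i(\sigma(t))$ be the neighbor set of $i$ in $\mathcal{G}_{\sigma(t)}=(\mathcal{V},\mathcal{E}_{\sigma(t)})$. Let $a_{ij}(t)=a_{ji}(t)$ be continuous weights with $a_*\le a_{ij}(t)\le a^*$ for all $i,j$, $t\ge0$, for constants $a_*,a^*>0$. Apply the control $$\tau_i=C_i(q_i,\dot q_i)\dot q_i-kM_i(q_i)\dot q_i-M_i(q_i)(q_i-P_{\mathcal{X}_i}(q_i))-M_i(q_i)\sum_{j\in\mathcal{N}_i(\sigma(t))}a_{ij}(t)(q_i-q_j).$$ Suppose the graph is uniformly jointly connected: there is $T>0$ such that for every $t\ge t_0$ the union graph $(\mathcal{V},\bigcup_{s\in[t,t+T)}\mathcal{E}_{\sigma(s)})$ is connected. Then for all sufficiently large $k>0$, every solution satisfies $\lim_{t\to\infty}\|q_i(t)\|_{\mathcal{X}_0}=0$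 for all $i$, $\lim_{t\to\infty}(q_i(t)-q_j(t))=0$ for all $i,j$, and $\lim_{t\to\infty}\dot q_i(t)=0$ for all $i$.
   Context: $\|\cdot\|$ is the Euclidean norm, $\|x\|_{\mathcal{S}}=\inf_{y\in\mathcal{S}}\|x-y\|$, and $P_{\mathcal{S}}(x)$ is the Euclidean projection of $x$ onto a closed convex set $\mathcal{S}$. *)

(* Defs.v *)
From HB Require Import structures.
From mathcomp Require Import all_boot all_order all_algebra.
From mathcomp Require Import all_classical all_reals all_analysis.
From Stdlib Require Import Relation_Operators.
Set Implicit Arguments. Unset Strict Implicit. Unset Printing Implicit Defensive.
Import Order.TTheory GRing.Theory Num.Theory.
Import numFieldNormedType.Exports.
Local Open Scope classical_set_scope.
Local Open Scope ring_scope.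

Section Defs.
Variables (R : realType) (m : nat).
Local Notation vec := 'cV[R]_m.

Definition enorm (x : vec) : R := Num.sqrt (\sum_(j < m) (x j ord0) ^+ 2).

Definition cvx_set (X : set vec) : Prop :=
  forall x y, X x -> X y -> forall l : R, 0 <= l <= 1 ->
    X (l *: x + (1 - l) *: y).

Definition bounded_eucl (X : set vec) : Prop :=
  exists r : R, forall x, X x -> enorm x <= r.

Definition edist_set (S : set vec) (x : vec) : R :=
  inf [set enorm (x - y) | y in S].

Definition is_eproj (S : set vec) (x p : vec) : Prop :=
  S p /\ forall y, S y -> enorm (x - p) <= enorm (x - y).

(* P_S(x): the (unique, for S closed convex nonempty) Euclidean projection *)
Definition eproj (S : set vec) (x : vec) : vec := xget 0 (is_eproj S x).

Definition spd (A : 'M[R]_m) : Prop :=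
  A^T = A /\ forall v : vec, v != 0 -> 0 < (v^T *m A *m v) ord0 ord0.
End Defs.

Definition connected_graph (n : nat) (e : 'I_n -> 'I_n -> Prop) : Prop :=
  forall i j : 'I_n, clos_refl_trans 'I_n (fun a b => e a b \/ e b a) i j.

(* Main.v *)
Require Import Defs.
From HB Require Import structures.
From mathcomp Require Import all_boot all_order all_algebra.
From mathcomp Require Import all_classical all_reals all_analysis.
From mathcomp Require Import ring lra.
Import Order.TTheory GRing.Theory Num.Theory.
Import numFieldNormedType.Exports.
Local Open Scope classical_set_scope.
Local Open Scope ring_scope.

(** Positive definiteness of [M_i] reduces the closed loop to
    [v' = - (k v + g + l)], where [v = q'], [g_i = q_i - P_i(q_i)] and
    [l_i = \sum_j w_ij (q_i - q_j)].  For [y] in the intersection of the [X_i],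
    the energy [\sum_i |k (q_i - y) + v_i|^2 + |v_i|^2] has derivative at most
    [- G], with [G = \sum_i (|g_i|^2 + |v_i|^2) + \sum_ij w_ij |q_i - q_j|^2], once
    [k >= 3] and [k >= 2 n a^* + 2]: the projection gives [<q_i - y, g_i> >= |g_i|^2],
    the Laplacian gives [2 \sum_i <q_i - y, l_i> = \sum_ij w_ij |q_i - q_j|^2] and
    [|l|^2 <= n a^* \sum_ij w_ij |q_i - q_j|^2].  No derivative of the weights or of
    the distance functions enters.  The energy being bounded below, every late
    time window of fixed length contains a time at which [G] is small.  As [v] is
    Lipschitz, [v] tends to 0; hence [q] is nearly constant on windows of fixed
    length, so [g] tends to 0, and [q_i - q_j] is small as soon as the edge [ij]
    is active somewhere in the window; joint connectivity extends this to all
    pairs.  Compactness finally turns closeness to every [X_j] into closeness to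
    their intersection. *)

(** * Euclidean geometry and projections *)

Definition dot {R : realType} {m : nat} (x y : 'cV[R]_m) : R :=
  \sum_(c < m) x c ord0 * y c ord0.

Lemma dotC {R : realType} {m : nat} (x y : 'cV[R]_m) : dot x y = dot y x.
Proof. by apply: eq_bigr => c _; rewrite mulrC. Qed.

Lemma dotDl {R : realType} {m : nat} (x y z : 'cV[R]_m) :
  dot (x + y) z = dot x z + dot y z.
Proof. by rewrite -big_split; apply: eq_bigr => c _; rewrite mxE mulrDl. Qed.

Lemma dotZl {R : realType} {m : nat} (l : R) (x z : 'cV[R]_m) :
  dot (l *: x) z = l * dot x z.
Proof. by rewrite mulr_sumr; apply: eq_bigr => c _; rewrite mxE mulrA. Qed.

Lemma dotNl {R : realType} {m : nat} (x z : 'cV[R]_m) : dot (- x) z = - dot x z.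
Proof. by rewrite -scaleN1r dotZl mulN1r. Qed.

Lemma dotDr {R : realType} {m : nat} (x y z : 'cV[R]_m) :
  dot z (x + y) = dot z x + dot z y.
Proof. by rewrite ![dot z _]dotC dotDl. Qed.

Lemma dotZr {R : realType} {m : nat} (l : R) (x z : 'cV[R]_m) :
  dot z (l *: x) = l * dot z x.
Proof. by rewrite ![dot z _]dotC dotZl. Qed.

Lemma dotNr {R : realType} {m : nat} (x z : 'cV[R]_m) : dot z (- x) = - dot z x.
Proof. by rewrite ![dot z _]dotC dotNl. Qed.

Lemma dot_ge0 {R : realType} {m : nat} (x : 'cV[R]_m) : 0 <= dot x x.
Proof. by apply: sumr_ge0 => c _; rewrite -expr2 sqr_ge0. Qed.

Lemma enorm_dot {R : realType} {m : nat} (x : 'cV[R]_m) :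
  enorm x = Num.sqrt (dot x x).
Proof. by congr Num.sqrt; apply: eq_bigr => c _; rewrite expr2. Qed.

Lemma enorm_ge0 {R : realType} {m : nat} (x : 'cV[R]_m) : 0 <= enorm x.
Proof. exact: sqrtr_ge0. Qed.

Lemma sqr_enorm {R : realType} {m : nat} (x : 'cV[R]_m) : enorm x ^+ 2 = dot x x.
Proof. by rewrite enorm_dot sqr_sqrtr// dot_ge0. Qed.

Lemma le_enorm {R : realType} {m : nat} (x : 'cV[R]_m) (r : R) :
  0 <= r -> (enorm x <= r) = (dot x x <= r ^+ 2).
Proof. by move=> r0; rewrite -sqr_enorm ler_sqr// nnegrE enorm_ge0. Qed.

Lemma coord_le_enorm {R : realType} {m : nat} (x : 'cV[R]_m) c :
  `|x c ord0| <= enorm x.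
Proof.
rewrite -sqrtr_sqr; apply: ler_wsqrtr; rewrite (bigD1 c)//= lerDl.
by apply: sumr_ge0 => i _; rewrite sqr_ge0.
Qed.

(** Cauchy-Schwarz: expand the square of [enorm y *: x - enorm x *: y] and cancel the factor
    [enorm x * enorm y]. Vanishing norms, which forbid the cancellation, are treated first. *)
Lemma dot_le_enorm {R : realType} {m : nat} (x y : 'cV[R]_m) :
  dot x y <= enorm x * enorm y.
Proof.
have [a0|a0] := eqVneq (enorm x) 0.
  rewrite a0 mul0r /dot big1// => c _.
  by have := coord_le_enorm x c; rewrite a0 normr_le0 => /eqP ->; rewrite mul0r.
have [b0|b0] := eqVneq (enorm y) 0.
  rewrite b0 mulr0 /dot big1// => c _.
  by have := coord_le_enorm y c; rewrite b0 normr_le0 => /eqP ->; rewrite mulr0.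
have := dot_ge0 (enorm y *: x - enorm x *: y).
rewrite !(dotDl, dotDr, dotNl, dotNr, dotZl, dotZr) -!sqr_enorm (dotC y x).
have ap : 0 < enorm x by rewrite lt_def a0 enorm_ge0.
have bp : 0 < enorm y by rewrite lt_def b0 enorm_ge0.
have abp : 0 < enorm x * enorm y by rewrite mulr_gt0.
move=> h; rewrite -(ler_pM2l abp); nra.
Qed.

Lemma enormD {R : realType} {m : nat} (x y : 'cV[R]_m) :
  enorm (x + y) <= enorm x + enorm y.
Proof.
rewrite le_enorm; last by rewrite addr_ge0 ?enorm_ge0.
rewrite !(dotDl, dotDr) (dotC y x) -!sqr_enorm.
have := dot_le_enorm x y; nra.
Qed.

Lemma enormN {R : realType} {m : nat} (x : 'cV[R]_m) : enorm (- x) = enorm x.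
Proof. by rewrite !enorm_dot dotNl dotNr opprK. Qed.

Lemma enormB {R : realType} {m : nat} (x y : 'cV[R]_m) :
  enorm (x - y) = enorm (y - x).
Proof. by rewrite -enormN opprB. Qed.

Lemma enormZ {R : realType} {m : nat} (l : R) (x : 'cV[R]_m) :
  enorm (l *: x) = `|l| * enorm x.
Proof.
by rewrite !enorm_dot dotZl dotZr mulrA -expr2 sqrtrM ?sqr_ge0// sqrtr_sqr.
Qed.

Lemma enorm_sum {R : realType} {m n : nat} (u : 'I_n -> 'cV[R]_m) :
  enorm (\sum_j u j) <= \sum_j enorm (u j).
Proof.
elim/big_ind2 : _ => // [|x a y b xa yb].
  by rewrite enorm_dot /dot big1 ?sqrtr0// => c _; rewrite mxE mul0r.
by apply: le_trans (enormD _ _) _; rewrite lerD.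
Qed.

Lemma enorm_triangle {R : realType} {m : nat} (x y z : 'cV[R]_m) :
  enorm (x - z) <= enorm (x - y) + enorm (y - z).
Proof. by apply: le_trans (enormD _ _); rewrite addrA subrK. Qed.

Lemma mx_norm_le_coord {R : realType} {m : nat} (x : 'cV[R]_m) (r : R) :
  0 <= r -> (`|x| <= r) <-> (forall c, `|x c ord0| <= r).
Proof.
move=> r0; rewrite /Num.Def.normr/= mx_normrE; split=> [h c|h].
  by move/bigmax_leP: h => [_ /(_ (c, ord0) isT)].
apply/bigmax_leP; split=> // -[c i] _ /=; rewrite (ord1 i); exact: h.
Qed.

Lemma norm_le_enorm {R : realType} {m : nat} (x : 'cV[R]_m) : `|x| <= enorm x.
Proof. by apply: (mx_norm_le_coord x _ (enorm_ge0 x)).2; exact: coord_le_enorm. Qed.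

Lemma enorm_le_coord {R : realType} {m : nat} (x : 'cV[R]_m) (r : R) :
  (forall c, `|x c ord0| <= r) -> enorm x <= m%:R * r.
Proof.
move=> h; case: m x h => [|m] x h.
  (* For [m = 0] the hypothesis is vacuous and [r] may be negative, but both sides vanish. *)
  by rewrite mul0r enorm_dot /dot big_ord0 sqrtr0.
have r0 : 0 <= r by apply: le_trans (h ord0).
rewrite le_enorm ?mulr_ge0//.
apply: (@le_trans _ _ (\sum_(c < m.+1) r ^+ 2)).
  by apply: ler_sum => c _; rewrite -expr2 -real_normK ?num_real// ler_sqr ?nnegrE.
rewrite sumr_const card_ord -[leLHS]mulr_natl exprMn ler_wpM2r ?sqr_ge0//.
by rewrite expr2 -natrM ler_nat leq_pmulr.
Qed.

Lemma enorm_le_norm {R : realType} {m : nat} (x : 'cV[R]_m) :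
  enorm x <= m%:R * `|x|.
Proof.
by apply: enorm_le_coord; apply: (mx_norm_le_coord x _ (normr_ge0 x)).1.
Qed.

(** The topology on column vectors is that of the maximum norm, so [enorm_le_norm] transfers
    continuity. The divisor [m%:R + 1] is nonzero even for [m = 0]. *)
Lemma enorm_continuous {R : realType} {m : nat} (z : 'cV[R]_m) :
  continuous (fun x : 'cV[R]_m => enorm (z - x)).
Proof.
move=> x; apply/(@cvgrPdist_le _ _ _ (nbhs x)) => e e0.
have m0 : 0 < m%:R + 1 :> R by rewrite ltr_wpDl.
near=> y.
have xy : `|x - y| <= e / (m%:R + 1).
  have : ball x (e / (m%:R + 1)) y.
    by near: y; apply: nbhsx_ballx; rewrite divr_gt0.
  by rewrite -ball_normE => /ltW.
have exy : enorm (x - y) <= e.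
  apply: le_trans (enorm_le_norm _) _.
  apply: (@le_trans _ _ ((m%:R + 1) * (e / (m%:R + 1)))).
    by apply: ler_pM => //; rewrite lerDl.
  by rewrite mulrC divfK// gt_eqF.
have h1 := enorm_triangle z x y.
have h2 := enorm_triangle z y x.
rewrite enormB in exy; move: h1; rewrite (enormB x y) => h1.
by rewrite ler_norml; lra.
Unshelve. all: by end_near. Qed.

Lemma trmx_continuous {R : realType} {m n : nat} :
  continuous (@trmx R m n).
Proof.
move=> A P /nbhs_ballP[e e0 eP]; apply/nbhs_ballP; exists e => // B [_ AB].
by apply: eP; split=> // i j; rewrite !mxE.
Qed.

Lemma compact_cV_box {R : realType} {m : nat} (r : R) :
  compact [set x : 'cV[R]_m | forall c, `|x c ord0| <= r].
Proof.
have -> : [set x : 'cV[R]_m | forall c, `|x c ord0| <= r] =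
    trmx @` [set v : 'rV[R]_m | forall c, `[(- r), r]%classic (v ord0 c)].
  apply/seteqP; split=> [x h|_ [v h <-] c] /=; last first.
    by have := h c; rewrite mxE /= in_itv/= ler_norml.
  by exists x^T; rewrite ?trmxK// => c /=; rewrite mxE in_itv/= -ler_norml.
apply: continuous_compact; first exact/continuous_subspaceT/trmx_continuous.
apply: (@rV_compact _ _ (fun=> `[(- r), r]%classic)) => c.
exact: segment_compact.
Qed.

(** * Existence and variational properties of the projection *)

(** The distance to [x] attains its minimum on the part of [S] in a compact box. The box contains
    every point of [S] at least as close to [x] as [y], so this minimum is global. *)
Lemma eprojP {R : realType} {m : nat} (S : set 'cV[R]_m) (x : 'cV[R]_m) :
  closed S -> S !=set0 -> is_eproj S x (eproj S x).
Proof.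
move=> cS [y Sy]; suff h : exists p, is_eproj S x p by exact: xgetPex.
pose K := S `&` [set z | forall c, `|z c ord0| <= enorm x + enorm (x - y)].
have cK : compact K.
  rewrite /K setIC; apply: compact_closedI => //; exact: compact_cV_box.
have small z : enorm (x - z) <= enorm (x - y) ->
    forall c, `|z c ord0| <= enorm x + enorm (x - y).
  move=> h c; apply: le_trans (coord_le_enorm _ _) _.
  have := enormD x (z - x); rewrite (addrC x) subrK => /le_trans; apply.
  by rewrite lerD2l (enormB z).
have Ky : K y by split=> //; exact: small.
have [|p] := @compact_EVT_min 'cV[R]_m R (fun z => enorm (x - z)) K
  (ex_intro _ y Ky) cK.
  exact/continuous_subspaceT/enorm_continuous.
rewrite inE => -[Sp _] hmin; exists p; split=> // z Sz.
have [h|/ltW h] := leP (enorm (x - z)) (enorm (x - y)).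
  by apply: hmin; rewrite inE; split=> //; exact: small.
by apply: le_trans h; apply: hmin; rewrite inE.
Qed.

(** Moving from [p] a fraction [l] of the way to [y] stays in [S] and cannot reduce the distance to
    [x]. If [d] were positive, the linear gain [2 * l * d] would beat the quadratic loss
    [l ^+ 2 * N] for small [l]. *)
Lemma is_eproj_obtuse {R : realType} {m : nat} {S : set 'cV[R]_m}
    {x p y : 'cV[R]_m} :
  cvx_set S -> is_eproj S x p -> S y -> dot (x - p) (y - p) <= 0.
Proof.
move=> cS [Sp hp] Sy; rewrite leNgt; apply/negP => d0.
set d := dot (x - p) (y - p) in d0.
set N := dot (y - p) (y - p).
have N0 : 0 <= N := dot_ge0 _.
have key l : 0 <= l <= 1 -> 2 * l * d <= l ^+ 2 * N.
  move=> hl; have /hp := cS _ _ Sy Sp l hl.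
  have -> : x - (l *: y + (1 - l) *: p) = (x - p) - l *: (y - p).
    by apply/matrixP => i j; rewrite !mxE; ring.
  rewrite le_enorm ?enorm_ge0// sqr_enorm.
  rewrite [leRHS]dotDl ![dot _ (_ - l *: _)]dotDr.
  rewrite !(dotNl, dotNr, dotZl, dotZr) (dotC (y - p)) -/d -/N; lra.
have dN : 0 < d + N by rewrite ltr_pwDl.
(* [l = d / (d + N)] violates [key]. *)
have /key : 0 <= d / (d + N) <= 1.
  apply/andP; split; first exact: divr_ge0 (ltW d0) (ltW dN).
  by rewrite ler_pdivrMr// mul1r lerDl.
have : 0 < d / (d + N) by rewrite divr_gt0.
have : d / (d + N) * (d + N) = d by rewrite divfK// gt_eqF.
move: (d / (d + N)) => l; nra.
Qed.

(** The obtuse angle condition rearranged by [y - p = (x - p) - (x - y)]; it makes the constraint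
    force pull towards every point of [S]. *)
Lemma eproj_monotone {R : realType} {m : nat} {S : set 'cV[R]_m}
    {x p y : 'cV[R]_m} :
  cvx_set S -> is_eproj S x p -> S y ->
  dot (x - p) (x - p) <= dot (x - y) (x - p).
Proof.
move=> cS hp Sy; have := is_eproj_obtuse cS hp Sy.
have -> : y - p = (x - p) - (x - y) by apply/matrixP => i j; rewrite !mxE; ring.
by rewrite dotDr dotNr (dotC (x - y)); lra.
Qed.

(** The projection [r] of [y] competes with [p] as a point of [S] near [x]. *)
Lemma enorm_eproj_lip {R : realType} {m : nat} {S : set 'cV[R]_m}
    {x p y r : 'cV[R]_m} :
  is_eproj S x p -> is_eproj S y r ->
  enorm (x - p) <= enorm (x - y) + enorm (y - r).
Proof.
by move=> [_ hp] [Sr _]; apply: le_trans (hp _ Sr) (enorm_triangle _ _ _).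
Qed.

(** * Distance to a set and to an intersection *)

Lemma edist_set_ge0 {R : realType} {m : nat} (S : set 'cV[R]_m) x :
  S !=set0 -> 0 <= edist_set S x.
Proof.
move=> [y Sy]; apply: lb_le_inf; first by exists (enorm (x - y)), y.
by move=> _ [z _ <-]; exact: enorm_ge0.
Qed.

Lemma edist_set_le {R : realType} {m : nat} (S : set 'cV[R]_m) x y :
  S y -> edist_set S x <= enorm (x - y).
Proof.
move=> Sy; apply: ge_inf; last by exists y.
by exists 0 => _ [z _ <-]; exact: enorm_ge0.
Qed.

(** By contradiction: counterexamples [u N] for the tolerances [N.+1%:R^-1] lie in one compact box
    and have a cluster point [z]. Closedness puts [z] in every [X i], so a [u N] close to [z] is
    close to the intersection. *)
Lemma edist_bigcap_small {R : realType} {m : nat} {I : Type}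
    (X : I -> set 'cV[R]_m) (r e : R) :
  (forall i, closed (X i)) -> 0 < e ->
  exists2 d : R, 0 < d & forall x : 'cV[R]_m, (forall c, `|x c ord0| <= r) ->
    (forall i, exists2 p, X i p & enorm (x - p) <= d) ->
    edist_set [set x | forall i, X i x] x <= e.
Proof.
move=> cX e0; apply/not_exists2P => bad.
have /choice[u hu] : forall N : nat, exists x : 'cV[R]_m,
    [/\ forall c, `|x c ord0| <= r,
        forall i, exists2 p, X i p & enorm (x - p) <= N.+1%:R^-1 &
        e < edist_set [set x | forall i, X i x] x].
  move=> N; have [|/existsNP[x /not_implyP[h1 /not_implyP[h2 /negP h3]]]] :=
    bad N.+1%:R^-1; first by rewrite invr_gt0.
  by exists x; split=> //; rewrite ltNge.
have [|z [_ cz]] := @compact_cV_box R m r (u @ \oo) _.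
  by exists 0%N => // N _; have [] := hu N.
(* Intersecting a ball around [z] with a tail of the sequence yields both smallness conditions at
   the same index. *)
have near_z d : 0 < d -> exists2 N, N.+1%:R^-1 < d & `|z - u N| < d.
  move=> d0.
  have hN : (u @ \oo) (u @` [set N | N.+1%:R^-1 < d]).
    suff : \forall N \near \oo, (u @` [set N | N.+1%:R^-1 < d]) (u N) by [].
    near=> N; exists N => //=; near: N.
    exact: near_infty_natSinv_lt (PosNum d0).
  have [_ [[N /= Nd <-] Bz]] := cz _ _ hN (nbhsx_ballx z d d0).
  by exists N => //; move: Bz; rewrite -ball_normE.
have Xz i : X i z.
  apply: cX => B /nbhs_ballP[d /= d0 dB].
  have d2 : 0 < d / 2 by rewrite divr_gt0.
  have [N Nd zN] := near_z _ d2; have [_ /(_ i)[p Xp up] _] := hu N.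
  exists p; split=> //; apply: dB; rewrite -ball_normE /=.
  apply: le_lt_trans (ler_distD (u N) _ _) _; rewrite [ltRHS](splitr d) ltrD//.
  exact: le_lt_trans (norm_le_enorm _) (le_lt_trans up Nd).
have m0 : 0 < m%:R + 1 :> R by rewrite ltr_wpDl.
have [N _ zN] := near_z _ (divr_gt0 e0 m0).
have [_ _] := hu N; apply/negP; rewrite -leNgt.
apply: le_trans (edist_set_le _ _ z Xz) _; rewrite enormB.
apply: le_trans (enorm_le_norm _) _.
apply: (@le_trans _ _ ((m%:R + 1) * (e / (m%:R + 1)))).
  by apply: ler_pM => //; [rewrite lerDl|exact: ltW].
by rewrite mulrC divfK// gt_eqF.
Unshelve. all: by end_near. Qed.

(** If [A *m x = A *m y], the quadratic form vanishes at [x - y]. This removes the inertia matrices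
    from the closed loop. *)
Lemma spd_inj {R : realType} {m : nat} (A : 'M[R]_m) :
  spd A -> injective (fun x : 'cV[R]_m => A *m x).
Proof.
move=> [_ pA] x y /= Axy; apply/eqP; rewrite -subr_eq0; apply/negPn/negP.
by move=> /pA; rewrite -mulmxA mulmxBr Axy subrr mulmx0 mxE ltxx.
Qed.

Lemma is_derive_coord {R : realType} {m : nat} (f : R -> 'cV[R]_m)
    (df : 'cV[R]_m) (t : R) c :
  is_derive t 1 f df -> is_derive t 1 (fun s => f s c ord0) (df c ord0).
Proof.
move=> [Df <-]; split; first exact: (derivable_mxP f t 1).1.
by rewrite (derive_mx Df) mxE.
Qed.


(** * Increments across switching times *)

(** Induction on the exceptional points: split at the head [x] when it lies inside the interval, the
    increments of the two pieces adding up. With no exceptional point left, this is the mean value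
    theorem. *)
Lemma increment_le_seq {R : realType} {f df : R -> R} {t0 : R}
    (s : seq R) (c a b : R) :
  (forall t, t0 < t -> {for t, continuous f}) -> t0 < a -> a <= b ->
  (forall t, a < t < b -> t \notin s -> is_derive t 1 f (df t) /\ df t <= c) ->
  f b - f a <= c * (b - a).
Proof.
move=> fc; elim: s a b => [|x s IH] a b ta.
  rewrite le_eqVlt => /predU1P[->|ab] h; first by rewrite !subrr mulr0.
  have [||z zab ->] := @MVT R f df a b ab.
  - by move=> z; rewrite in_itv/= => /h[].
  - apply: continuous_in_subspaceT => z; rewrite inE/= in_itv/= => /andP[az _].
    by apply: fc; exact: lt_le_trans az.
  rewrite ler_pM2r ?subr_gt0//; move: zab; rewrite in_itv/= => /h[]//.
move=> ab h.
have sub a' b' : a <= a' -> b' <= b -> (a' >= x) || (b' <= x) -> forall t,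
    a' < t < b' -> t \notin s -> is_derive t 1 f (df t) /\ df t <= c.
  move=> aa bb' xab t /andP[at' tb'] ts; apply: h.
    by rewrite (le_lt_trans aa)// (lt_le_trans tb').
  rewrite inE negb_or ts andbT; apply/eqP => tx; move: xab.
  by rewrite -tx leNgt at'/= leNgt tb'.
have [xa|ax] := leP x a; first by apply: IH => //; apply: sub; rewrite ?xa.
have [bx|xb] := leP b x; first by apply: IH => //; apply: sub; rewrite ?bx ?orbT.
have h1 : f x - f a <= c * (x - a).
  by apply: IH => //; [exact: ltW|apply: sub; rewrite ?lexx ?orbT ?(ltW xb)].
have h2 : f b - f x <= c * (b - x).
  apply: IH => //; [exact: lt_trans ta ax|exact: ltW|].
  by apply: sub; rewrite ?lexx ?(ltW ax).
have -> : c * (b - a) = c * (b - x) + c * (x - a) by ring.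
by lra.
Qed.

Lemma dwell_lower_bound {R : realType} {ts : nat -> R} {taud : R} :
  (forall l, taud <= ts l.+1 - ts l) -> forall l, ts 0%N + l%:R * taud <= ts l.
Proof.
move=> h; elim=> [|l IH]; first by rewrite mul0r addr0.
by have := h l; rewrite -natr1 mulrDl mul1r; lra.
Qed.

(** Gaps of at least [taud] make the switching times grow at least linearly, so only finitely many
    of them precede [b]. *)
Lemma dwell_unbounded {R : realType} {ts : nat -> R} {taud : R} :
  0 < taud -> (forall l, taud <= ts l.+1 - ts l) ->
  forall b, exists L, forall l, (L <= l)%N -> b <= ts l.
Proof.
move=> td h b; exists (Num.truncn ((`|b| + `|ts 0%N|) / taud)).+1 => l Ll.
apply: le_trans (dwell_lower_bound h l).
have : (`|b| + `|ts 0%N|) / taud < l%:R.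
  by apply: lt_le_trans (truncnS_gt _) _; rewrite ler_nat.
rewrite ltr_pdivrMr//; have := ler_norm b; have := ler_norm (- ts 0%N).
by rewrite normrN; lra.
Qed.

(** Otherwise, by induction, no switching time would exceed [s]. *)
Lemma dwell_interval {R : realType} {ts : nat -> R} {taud : R} {s : R} :
  0 < taud -> (forall l, taud <= ts l.+1 - ts l) -> ts 0%N <= s ->
  exists l, ts l <= s < ts l.+1.
Proof.
move=> td h ts0s; apply: contrapT => /forallNP no.
have le l : ts l <= s.
  elim: l => // l IH; rewrite leNgt; apply/negP => sl.
  by apply: (no l); rewrite IH.
have [L hL] := dwell_unbounded td h (s + 1).
by have := hL L (leqnn _); have := le L; lra.
Qed.

Lemma increment_le {R : realType} {f df : R -> R} {t0 : R} {ts : nat -> R}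
    {taud : R} (c a b : R) :
  0 < taud -> (forall l, taud <= ts l.+1 - ts l) ->
  (forall t, t0 < t -> {for t, continuous f}) -> t0 < a -> a <= b ->
  (forall t, a < t < b -> (forall l, t <> ts l) ->
     is_derive t 1 f (df t) /\ df t <= c) ->
  f b - f a <= c * (b - a).
Proof.
move=> td hd fc ta ab h; have [L hL] := dwell_unbounded td hd b.
apply: (increment_le_seq [seq ts l | l <- iota 0 L]) fc ta ab _ => t tab nts.
apply: h => // l tl; have [/hL|lL] := leqP L l.
  by rewrite -tl leNgt; case/andP: tab => _ ->.
by move/negP: nts; apply; apply/mapP; exists l; rewrite ?mem_iota.
Qed.

Lemma abs_increment_le {R : realType} {f df : R -> R} {t0 : R} {ts : nat -> R}
    {taud : R} (c a b : R) :
  0 < taud -> (forall l, taud <= ts l.+1 - ts l) ->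
  (forall t, t0 < t -> {for t, continuous f}) -> t0 < a -> a <= b ->
  (forall t, a < t < b -> (forall l, t <> ts l) ->
     is_derive t 1 f (df t) /\ `|df t| <= c) ->
  `|f b - f a| <= c * (b - a).
Proof.
move=> td hd fc ta ab h; rewrite ler_norml lerNl opprB; apply/andP; split.
  have := @increment_le _ (- f) (- df) t0 ts taud c a b td hd _ ta ab.
  rewrite [(- f) b - _](_ : _ = f a - f b); last by rewrite opprK addrC.
  apply=> [t tt0|t tab nts]; first exact/continuousN/fc.
  have [D le] := h t tab nts; split; first exact: is_deriveN.
  by apply: le_trans le; rewrite -normrN; exact: (ler_norm (- df t)).
apply: (@increment_le _ f df t0 ts taud) => // t tab nts.
have [D le] := h t tab nts; split=> //.
by apply: le_trans le; exact: ler_norm.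
Qed.

(** * Consequences of a dissipation inequality *)

Lemma dissipation_decr {R : realType} {W dW G : R -> R} {t0 : R}
    {ts : nat -> R} {taud : R} :
  0 < taud -> (forall l, taud <= ts l.+1 - ts l) ->
  (forall t, t0 < t -> {for t, continuous W}) ->
  (forall t, t0 < t -> 0 <= G t) ->
  (forall t, t0 < t -> (forall l, t <> ts l) ->
     is_derive t 1 W (dW t) /\ dW t <= - G t) ->
  forall a b, t0 < a -> a <= b -> W b <= W a.
Proof.
move=> td hd Wc G0 hW a b ta ab.
have := @increment_le _ W dW _ _ _ 0 a b td hd Wc ta ab.
rewrite mul0r subr_le0; apply=> t /andP[at' _] nts.
have [D le] := hW t (lt_trans ta at') nts.
by split=> //; apply: le_trans le _; rewrite oppr_le0 G0// (lt_trans ta).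
Qed.

(** [W] is nonincreasing and bounded below. Once it is within [c * h] of its infimum, having [G] at
    least [c] at all non-switching times of a window of length [h] would push it below that
    infimum. *)
Lemma dissipation_small {R : realType} {W dW G : R -> R} {t0 : R}
    {ts : nat -> R} {taud : R} :
  0 < taud -> (forall l, taud <= ts l.+1 - ts l) ->
  (forall t, t0 < t -> {for t, continuous W}) ->
  (forall t, 0 <= W t) -> (forall t, t0 < t -> 0 <= G t) ->
  (forall t, t0 < t -> (forall l, t <> ts l) ->
     is_derive t 1 W (dW t) /\ dW t <= - G t) ->
  forall h c : R, 0 < h -> 0 < c -> \forall t \near +oo,
    exists s, [/\ t < s < t + h, forall l, s <> ts l & G s < c].
Proof.
move=> td hd Wc W0 G0 hW h c h0 c0.
have dec := dissipation_decr td hd Wc G0 hW.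
pose A := [set W t | t in [set t | t0 < t]].
have lbA : lbound A 0 by move=> _ [t _ <-].
have hA : has_inf A.
  by split; [exists (W (t0 + 1)), (t0 + 1) => //=; rewrite ltrDl|exists 0].
have [_ [S /= tS <-] WS] := inf_adherent (mulr_gt0 c0 h0) hA.
exists S; split; first exact: num_real.
move=> t /ltW St; apply: contrapT => /forallNP no.
have t0t := lt_le_trans tS St.
have tth : t <= t + h by rewrite lerDl ltW.
have := @increment_le _ W dW _ _ _ (- c) t (t + h) td hd Wc t0t tth.
have -> : t + h - t = h by ring.
have WtS := dec S t tS St.
have : inf A <= W (t + h).
  by apply: ge_inf; [exists 0|exists (t + h) => //=; lra].
move=> iA; suff : - c * h < W (t + h) - W t.
  rewrite ltNge => /negP nle h'; apply: nle; apply: h'.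
  move=> s tsh nts; have [D le] : is_derive s 1 W (dW s) /\ dW s <= - G s.
    by apply: hW => //; case/andP: tsh => ts' _; exact: lt_trans ts'.
  split=> //; apply: le_trans le _; rewrite lerN2 leNgt; apply/negP => Gc.
  by apply: (no s).
by move: WS; lra.
Qed.

(** * The closed loop *)

Lemma dot_sumr {R : realType} {m n : nat} (x : 'cV[R]_m) (u : 'I_n -> 'cV[R]_m) :
  dot x (\sum_j u j) = \sum_j dot x (u j).
Proof.
rewrite /dot exchange_big; apply: eq_bigr => c _.
by rewrite summxE mulr_sumr.
Qed.

Lemma dot_young {R : realType} {m : nat} (x y : 'cV[R]_m) :
  - (dot x x + dot y y) <= 2 * dot x y.
Proof.
have := dot_ge0 (x + y); rewrite !(dotDl, dotDr) (dotC y x); lra.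
Qed.

(** Each cross term [dot (u i) (u j)] is at most the half sum of the two squares. *)
Lemma dot_sum_le {R : realType} {m n : nat} (u : 'I_n -> 'cV[R]_m) :
  dot (\sum_j u j) (\sum_j u j) <= n%:R * \sum_j dot (u j) (u j).
Proof.
have -> : dot (\sum_j u j) (\sum_j u j) = \sum_i \sum_j dot (u i) (u j).
  by rewrite dot_sumr; apply: eq_bigr => i _; rewrite dotC dot_sumr.
apply: (@le_trans _ _
    (\sum_i \sum_j (2^-1 * dot (u i) (u i) + 2^-1 * dot (u j) (u j)))).
  apply: ler_sum => i _; apply: ler_sum => j _.
  by have := dot_young (u i) (- u j); rewrite !dotNr dotNl; lra.
under eq_bigr do rewrite big_split/= sumr_const card_ord -mulr_sumr.
rewrite big_split/= sumr_const card_ord sumrMnl -mulr_sumr -mulrnDl.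
rewrite -[leLHS]mulr_natl; set S := \sum_j _.
by have -> : 2^-1 * S + 2^-1 * S = S by lra.
Qed.

(** Exchange [i] and [j] in one of two copies of the sum: since [w] is symmetric,
    [dot (z i) (z i - z j)] and [dot (z j) (z j - z i)] pair up to the square of the difference. *)
Lemma laplacian_form {R : realType} {m n : nat} (w : 'I_n -> 'I_n -> R)
    (z : 'I_n -> 'cV[R]_m) : (forall i j, w i j = w j i) ->
  2 * \sum_i dot (z i) (\sum_j w i j *: (z i - z j)) =
  \sum_i \sum_j w i j * dot (z i - z j) (z i - z j).
Proof.
move=> ws.
have -> : \sum_i dot (z i) (\sum_j w i j *: (z i - z j)) =
    \sum_i \sum_j w i j * dot (z i) (z i - z j).
  by apply: eq_bigr => i _; rewrite dot_sumr; apply: eq_bigr => j _; rewrite dotZr.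
rewrite mulr_natl mulr2n {2}exchange_big -big_split; apply: eq_bigr => i _ /=.
rewrite -big_split; apply: eq_bigr => j _ /=; rewrite (ws j i) -mulrDr; congr *%R.
by rewrite !(dotDl, dotDr, dotNl, dotNr); ring.
Qed.

(** The bound [w ^+ 2 <= hi * w] keeps one factor [w], so that the squared coupling can be absorbed
    by the disagreement term. *)
Lemma laplacian_sqr {R : realType} {m n : nat} (w : 'I_n -> 'I_n -> R) (hi : R)
    (z : 'I_n -> 'cV[R]_m) : (forall i j, 0 <= w i j <= hi) ->
  \sum_i dot (\sum_j w i j *: (z i - z j)) (\sum_j w i j *: (z i - z j)) <=
  n%:R * hi * \sum_i \sum_j w i j * dot (z i - z j) (z i - z j).
Proof.
move=> wb; rewrite mulr_sumr; apply: ler_sum => i _.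
apply: le_trans (dot_sum_le _) _; rewrite -mulrA ler_wpM2l// mulr_sumr.
apply: ler_sum => j _; rewrite dotZl dotZr !mulrA ler_wpM2r ?dot_ge0//.
by case/andP: (wb i j) => w0 w1; rewrite ler_wpM2r.
Qed.

(** The right side is minus half the energy derivative, with [e] the positions relative to [y].
    Young's inequality turns the cross terms into squares of [v], [g] and [l]: the condition
    [3 <= k] pays for those of [v] and [g], the other gain condition for those of [l]. *)
Lemma dissipation_rate {R : realType} {m n : nat} (w : 'I_n -> 'I_n -> R)
    (hi k : R) (e v g l : 'I_n -> 'cV[R]_m) :
  (forall i j, w i j = w j i) -> (forall i j, 0 <= w i j <= hi) ->
  (forall i, dot (g i) (g i) <= dot (e i) (g i)) ->
  (forall i, l i = \sum_j w i j *: (e i - e j)) ->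
  3 <= k -> 2 * n%:R * hi + 2 <= k ->
  \sum_i (dot (g i) (g i) + dot (v i) (v i)) +
    \sum_i \sum_j w i j * dot (e i - e j) (e i - e j) <=
  \sum_i (dot (k *: e i + v i) (g i + l i) +
          dot (v i) (k *: v i + g i + l i)).
Proof.
move=> ws wb ge lE k3 kn.
set D := \sum_i \sum_j _.
have D0 : 0 <= D.
  apply: sumr_ge0 => i _; apply: sumr_ge0 => j _.
  by case/andP: (wb i j) => w0 _; rewrite mulr_ge0// dot_ge0.
have hl : 2 * \sum_i dot (e i) (l i) = D.
  by rewrite /D -(laplacian_form w e ws); under eq_bigr do rewrite lE.
have hs : \sum_i dot (l i) (l i) <= n%:R * hi * D.
  by under eq_bigr do rewrite lE; exact: laplacian_sqr.
have kD : (2 * n%:R * hi + 2) * D <= k * D by rewrite ler_wpM2r.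
(* The graph terms give at least [k * D / 2 - n%:R * hi * D], which is at least [D] by the gain
   condition. What remains is compared agent by agent. *)
apply: (@le_trans _ _ (\sum_i (dot (g i) (g i) + dot (v i) (v i)) +
    (k * \sum_i dot (e i) (l i) - \sum_i dot (l i) (l i)))).
  rewrite lerD2l; have -> : \sum_i dot (e i) (l i) = D / 2 by lra.
  lra.
rewrite mulr_sumr -sumrB -big_split; apply: ler_sum => i _ /=.
rewrite !(dotDl, dotDr, dotZl, dotZr).
have := dot_young (v i) (g i); have := dot_young (v i) (l i).
have := dot_ge0 (g i); have := dot_ge0 (v i); have := ge i.
have : k * dot (g i) (g i) <= k * dot (e i) (g i) by rewrite ler_wpM2l//; lra.
have : 3 * dot (g i) (g i) <= k * dot (g i) (g i) by rewrite ler_wpM2r ?dot_ge0.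
have : 3 * dot (v i) (v i) <= k * dot (v i) (v i) by rewrite ler_wpM2r ?dot_ge0.
lra.
Qed.

Lemma is_derive_fun_sum {R : realType} {n : nat} (h : 'I_n -> R -> R)
    (dh : 'I_n -> R) (t : R) :
  (forall i, is_derive t 1 (h i) (dh i)) ->
  is_derive t 1 (fun s => \sum_i h i s) (\sum_i dh i).
Proof.
move=> hd; have := is_derive_sum hd.
by congr (is_derive _ _ _ _); apply/funext => s; rewrite fct_sumE.
Qed.

Lemma is_derive_dot {R : realType} {m : nat} (f : R -> 'cV[R]_m)
    (df : 'cV[R]_m) (t : R) :
  is_derive t 1 f df ->
  is_derive t 1 (fun s => dot (f s) (f s)) (2 * dot (f t) df).
Proof.
move=> hf; rewrite /dot mulr_sumr; apply: is_derive_fun_sum => c.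
have hc := is_derive_coord f df t c hf.
have := is_deriveM hc hc; congr (is_derive _ _ _ _).
by rewrite /GRing.scale/=; ring.
Qed.

Lemma continuous_coord {R : realType} {m : nat} {f : R -> 'cV[R]_m} {t : R} c :
  {for t, continuous f} -> {for t, continuous (fun s => f s c ord0)}.
Proof.
move=> hf; apply: (@continuous_comp _ _ _ f (fun M : 'cV[R]_m => M c ord0)) => //.
exact: coord_continuous.
Qed.

Lemma continuous_fun_sum {R : realType} {n : nat} (h : 'I_n -> R -> R) (t : R) :
  (forall i, {for t, continuous (h i)}) ->
  {for t, continuous (fun s => \sum_i h i s)}.
Proof.
move=> hc; apply: cvg_big => [|i _]; first exact: add_continuous.
exact: hc.
Qed.

Lemma continuous_dot {R : realType} {m : nat} (f : R -> 'cV[R]_m) (t : R) :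
  {for t, continuous f} -> {for t, continuous (fun s => dot (f s) (f s))}.
Proof.
move=> hf; apply: continuous_fun_sum => c.
by apply: continuousM; exact: continuous_coord.
Qed.

Set Implicit Arguments.

(* [y] is a point of all the constraint sets, [g i t] stands for
   [q i t - P_i (q i t)] and [w t i j] for the weight [a i j t] if the edge [ij]
   is active at [t], and 0 otherwise. *)
Record consensus_loop {R : realType} {n m : nat} (k hi t0 taud : R)
    (ts : nat -> R) (y : 'cV[R]_m) (q v g : 'I_n -> R -> 'cV[R]_m)
    (w : R -> 'I_n -> 'I_n -> R) : Prop := {
  loop_dwell_gt0 : 0 < taud;
  loop_dwell : forall l, taud <= ts l.+1 - ts l;
  loop_position : forall i t, t0 < t -> is_derive t 1 (q i) (v i t);
  loop_velocity_continuous : forall i t, t0 < t -> {for t, continuous (v i)};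
  loop_velocity : forall i t, t0 < t -> (forall l, t <> ts l) ->
    is_derive t 1 (v i)
      (- (k *: v i t + g i t + \sum_j w t i j *: (q i t - q j t)));
  loop_force_inward : forall i t, dot (g i t) (g i t) <= dot (q i t - y) (g i t);
  loop_force_lip : forall i s t,
    enorm (g i s) <= enorm (q i s - q i t) + enorm (g i t);
  loop_weight_sym : forall t i j, w t i j = w t j i;
  loop_weight_bounds : forall t i j, t0 < t -> 0 <= w t i j <= hi;
  loop_hi_ge0 : 0 <= hi;
  loop_gain3 : 3 <= k;
  loop_gain : 2 * n%:R * hi + 2 <= k
}.

Unset Implicit Arguments.

(** * Energy and dissipation along the closed loop *)

(** In the derivative of [k *: (q i t - y) + v i t] the damping cancels, leaving only the constraint
    force and the coupling. The second square supplies the damping term in the velocities. *)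
Definition loop_energy {R : realType} {n m : nat} (k : R) (y : 'cV[R]_m)
    (q v : 'I_n -> R -> 'cV[R]_m) (t : R) : R :=
  \sum_i (dot (k *: (q i t - y) + v i t) (k *: (q i t - y) + v i t) +
          dot (v i t) (v i t)).

Definition loop_dissipation {R : realType} {n m : nat}
    (q v g : 'I_n -> R -> 'cV[R]_m) (w : R -> 'I_n -> 'I_n -> R) (t : R) : R :=
  \sum_i (dot (g i t) (g i t) + dot (v i t) (v i t)) +
  \sum_i \sum_j w t i j * dot (q i t - q j t) (q i t - q j t).

(* The time derivative of [loop_energy]. *)
Definition loop_power {R : realType} {n m : nat} (k : R) (y : 'cV[R]_m)
    (q v g : 'I_n -> R -> 'cV[R]_m) (w : R -> 'I_n -> 'I_n -> R) (t : R) : R :=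
  \sum_i (2 * dot (k *: (q i t - y) + v i t)
              (k *: v i t -
               (k *: v i t + g i t + \sum_j w t i j *: (q i t - q j t))) +
          2 * dot (v i t)
              (- (k *: v i t + g i t + \sum_j w t i j *: (q i t - q j t)))).

Lemma loop_energy_ge0 {R : realType} {n m : nat} (k : R) (y : 'cV[R]_m)
    (q v : 'I_n -> R -> 'cV[R]_m) (t : R) : 0 <= loop_energy k y q v t.
Proof. by apply: sumr_ge0 => i _; rewrite addr_ge0 ?dot_ge0. Qed.

Lemma loop_dissipation_ge0 {R : realType} {n m : nat} {k hi t0 taud : R} {ts y}
    {q v g : 'I_n -> R -> 'cV[R]_m} {w : R -> 'I_n -> 'I_n -> R} :
  consensus_loop k hi t0 taud ts y q v g w ->
  forall t, t0 < t -> 0 <= loop_dissipation q v g w t.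
Proof.
move=> H t ht; apply: addr_ge0; apply: sumr_ge0 => i _.
  by rewrite addr_ge0 ?dot_ge0.
apply: sumr_ge0 => j _; rewrite mulr_ge0 ?dot_ge0//.
by case/andP: (loop_weight_bounds H t i j ht).
Qed.

Lemma loop_dissipation_ge {R : realType} {n m : nat} {k hi t0 taud : R} {ts y}
    {q v g : 'I_n -> R -> 'cV[R]_m} {w : R -> 'I_n -> 'I_n -> R} :
  consensus_loop k hi t0 taud ts y q v g w ->
  forall t i j, t0 < t ->
  [/\ dot (g i t) (g i t) <= loop_dissipation q v g w t,
      dot (v i t) (v i t) <= loop_dissipation q v g w t &
      w t i j * dot (q i t - q j t) (q i t - q j t) <=
        loop_dissipation q v g w t].
Proof.
move=> H t i j ht; rewrite /loop_dissipation.
have W0 a b : 0 <= w t a b * dot (q a t - q b t) (q a t - q b t).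
  rewrite mulr_ge0 ?dot_ge0//.
  by case/andP: (loop_weight_bounds H t a b ht).
have S0 : 0 <= \sum_a (dot (g a t) (g a t) + dot (v a t) (v a t)).
  by apply: sumr_ge0 => a _; rewrite addr_ge0 ?dot_ge0.
have D0 : 0 <= \sum_a \sum_b w t a b * dot (q a t - q b t) (q a t - q b t).
  by apply: sumr_ge0 => a _; apply: sumr_ge0.
have gv : dot (g i t) (g i t) + dot (v i t) (v i t) <=
    \sum_a (dot (g a t) (g a t) + dot (v a t) (v a t)).
  rewrite [leRHS](bigD1 i)//= lerDl; apply: sumr_ge0 => a _.
  by rewrite addr_ge0 ?dot_ge0.
have ww : w t i j * dot (q i t - q j t) (q i t - q j t) <=
    \sum_a \sum_b w t a b * dot (q a t - q b t) (q a t - q b t).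
  apply: (@le_trans _ _ (\sum_b w t i b * dot (q i t - q b t) (q i t - q b t))).
    by rewrite [leRHS](bigD1 j)//= lerDl; apply: sumr_ge0.
  rewrite [leRHS](bigD1 i)//= lerDl.
  by apply: sumr_ge0 => a _; apply: sumr_ge0.
have := dot_ge0 (g i t); have := dot_ge0 (v i t).
by split; lra.
Qed.

Lemma loop_energy_continuous {R : realType} {n m : nat} {k hi t0 taud : R} {ts y}
    {q v g : 'I_n -> R -> 'cV[R]_m} {w : R -> 'I_n -> 'I_n -> R} :
  consensus_loop k hi t0 taud ts y q v g w ->
  forall t, t0 < t -> {for t, continuous (loop_energy k y q v)}.
Proof.
move=> H t ht; apply: continuous_fun_sum => i.
have vc : {for t, continuous (v i)} by exact: loop_velocity_continuous H i t ht.
have qc : {for t, continuous (q i)}.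
  have [D _] := loop_position H i t ht.
  exact/differentiable_continuous/derivable1_diffP.
apply: continuousD; last exact: continuous_dot.
apply: continuous_dot; apply: continuousD => //.
apply: cvgZl_tmp; apply: cvgB => //; exact: cvg_cst.
Qed.

Lemma loop_energy_derive {R : realType} {n m : nat} {k hi t0 taud : R} {ts y}
    {q v g : 'I_n -> R -> 'cV[R]_m} {w : R -> 'I_n -> 'I_n -> R} :
  consensus_loop k hi t0 taud ts y q v g w ->
  forall t, t0 < t -> (forall l, t <> ts l) ->
    is_derive t 1 (loop_energy k y q v) (loop_power k y q v g w t) /\
    loop_power k y q v g w t <= - loop_dissipation q v g w t.
Proof.
move=> H t ht nts; split.
  apply: is_derive_fun_sum => i.
  have Dv := loop_velocity H i ht nts.
  have Dq := loop_position H i t ht.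
  apply: is_deriveD; apply: is_derive_dot => //.
  apply: is_deriveD; apply: is_deriveZ.
  by have := is_deriveB Dq (is_derive_cst y t 1); rewrite subr0.
(* The coupling depends on differences only, so positions can be shifted by [y] to fit
   [dissipation_rate]. *)
pose l i := \sum_j w t i j *: (q i t - q j t).
have e2 i j : q i t - y - (q j t - y) = q i t - q j t.
  by rewrite opprB addrA subrK.
have lE i : l i = \sum_j w t i j *: (q i t - y - (q j t - y)).
  by apply: eq_bigr => j _; rewrite e2.
have := dissipation_rate (w t) hi k (fun i => q i t - y) (v ^~ t) (g ^~ t) l
  (loop_weight_sym H t) (fun i j => loop_weight_bounds H t i j ht)
  (fun i => loop_force_inward H i t) lE (loop_gain3 H) (loop_gain H).
under [X in _ + X <= _]eq_bigr do under eq_bigr do rewrite e2.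
rewrite -/(loop_dissipation q v g w t) => rate.
have -> : loop_power k y q v g w t =
    - (2 * \sum_i (dot (k *: (q i t - y) + v i t) (g i t + l i) +
                   dot (v i t) (k *: v i t + g i t + l i))).
  rewrite mulr_sumr -sumrN; apply: eq_bigr => i _; rewrite -/(l i) dotNr.
  have -> : k *: v i t - (k *: v i t + g i t + l i) = - (g i t + l i).
    by rewrite -addrA opprD addNKr.
  by rewrite dotNr; ring.
(* The rate gives minus twice the dissipation; its nonnegativity weakens this to the stated
   bound. *)
have := loop_dissipation_ge0 H t ht; lra.
Qed.

(** * Long-time behaviour of the closed loop *)

Lemma near_pinfty_ge {R : realType} {P : R -> Prop} :
  (\forall t \near +oo, P t) -> \forall t \near +oo, forall s, t <= s -> P s.
Proof.
move=> [M [Mr hM]]; exists M; split=> // t Mt s ts.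
by apply: hM; exact: lt_le_trans ts.
Qed.

Lemma loop_small {R : realType} {n m : nat} {k hi t0 taud : R} {ts y}
    {q v g : 'I_n -> R -> 'cV[R]_m} {w : R -> 'I_n -> 'I_n -> R} :
  consensus_loop k hi t0 taud ts y q v g w ->
  forall h c : R, 0 < h -> 0 < c -> \forall t \near +oo,
    exists s, [/\ t < s < t + h, forall l, s <> ts l &
      loop_dissipation q v g w s < c].
Proof.
move=> H; apply: dissipation_small (loop_energy_derive H).
- exact: loop_dwell_gt0 H.
- exact: loop_dwell H.
- exact: loop_energy_continuous H.
- exact: loop_energy_ge0.
- exact: loop_dissipation_ge0 H.
Qed.

(** The energy does not increase, so its value at [t0 + 1] bounds both [v] and [k *: (q - y) + v] by
    [B]. Hence [k] times the norm of [q - y] is at most [B + B], and [3 <= k] gives the bound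
    [B]. *)
Lemma loop_bounded {R : realType} {n m : nat} {k hi t0 taud : R} {ts y}
    {q v g : 'I_n -> R -> 'cV[R]_m} {w : R -> 'I_n -> 'I_n -> R} :
  consensus_loop k hi t0 taud ts y q v g w ->
  exists2 B : R, 0 <= B & \forall t \near +oo, forall i,
    enorm (q i t - y) <= B /\ enorm (v i t) <= B.
Proof.
move=> H; have k3 := loop_gain3 H; pose W := loop_energy k y q v.
pose B := Num.sqrt (W (t0 + 1)).
exists B; first exact: sqrtr_ge0.
exists (t0 + 1); split; first exact: num_real.
move=> t /ltW t1 i.
have W0 u : 0 <= W u := loop_energy_ge0 k y q v u.
have BE : B ^+ 2 = W (t0 + 1) by rewrite sqr_sqrtr.
have WB : W t <= B ^+ 2.
  rewrite BE; apply: (dissipation_decr (loop_dwell_gt0 H) (loop_dwell H)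
    (loop_energy_continuous H) (loop_dissipation_ge0 H) (loop_energy_derive H)) => //.
  by rewrite ltrDl.
have termB : dot (k *: (q i t - y) + v i t) (k *: (q i t - y) + v i t) +
    dot (v i t) (v i t) <= B ^+ 2.
  apply: le_trans WB; rewrite /W /loop_energy (bigD1 i)//= lerDl.
  by apply: sumr_ge0 => j _; rewrite addr_ge0 ?dot_ge0.
have vB : enorm (v i t) <= B.
  rewrite le_enorm ?sqrtr_ge0//; apply: le_trans termB.
  by rewrite lerDr dot_ge0.
have zB : enorm (k *: (q i t - y) + v i t) <= B.
  rewrite le_enorm ?sqrtr_ge0//; apply: le_trans termB.
  by rewrite lerDl dot_ge0.
split=> //.
have : enorm (k *: (q i t - y)) <= B + B.
  rewrite -(addrK (v i t) (k *: (q i t - y))).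
  by apply: le_trans (enormD _ _) _; rewrite enormN lerD.
rewrite enormZ ger0_norm; last lra.
have := enorm_ge0 (q i t - y); have B0 : 0 <= B by exact: sqrtr_ge0.
nra.
Qed.

Lemma loop_force_bound {R : realType} {n m : nat} {k hi t0 taud : R} {ts y}
    {q v g : 'I_n -> R -> 'cV[R]_m} {w : R -> 'I_n -> 'I_n -> R} :
  consensus_loop k hi t0 taud ts y q v g w ->
  forall i t, enorm (g i t) <= enorm (q i t - y).
Proof.
move=> H i t; have [->|g0] := eqVneq (enorm (g i t)) 0; first exact: enorm_ge0.
have gp : 0 < enorm (g i t) by rewrite lt_def g0 enorm_ge0.
rewrite -(ler_pM2r gp) -expr2 sqr_enorm.
exact: le_trans (loop_force_inward H i t) (dot_le_enorm _ _).
Qed.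

(** A short window after [t] contains a time [s] of small dissipation, hence of small velocity. As
    the acceleration is bounded, the velocity at [t] is small too. *)
Lemma loop_velocity_cvg {R : realType} {n m : nat} {k hi t0 taud : R} {ts y}
    {q v g : 'I_n -> R -> 'cV[R]_m} {w : R -> 'I_n -> 'I_n -> R} :
  consensus_loop k hi t0 taud ts y q v g w ->
  forall e : R, 0 < e -> \forall t \near +oo, forall i c, `|v i t c ord0| <= e.
Proof.
move=> H e e0; have k3 := loop_gain3 H; have hi0 := loop_hi_ge0 H.
have [B B0 /near_pinfty_ge hB] := loop_bounded H.
(* [A] bounds the acceleration: damping [k * B], constraint force [B], and [n] couplings of size at
   most [hi * (B + B)]. The final 1 makes it positive. *)
pose A := k * B + B + n%:R * (hi * (B + B)) + 1.
have A0 : 0 < A.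
  by rewrite ltr_wpDl// !addr_ge0// ?mulr_ge0// ?addr_ge0//; lra.
have h0 : 0 < e / 2 / A by rewrite !divr_gt0.
have c0 : 0 < (e / 2) ^+ 2 by rewrite exprn_gt0// divr_gt0.
near=> t => i c.
have tt0 : t0 < t by near: t; apply: nbhs_pinfty_gt; exact: num_real.
have hBt s : t <= s -> forall i,
    enorm (q i s - y) <= B /\ enorm (v i s) <= B.
  by move: s; near: t.
have [s [/andP[ts' sth] nts Gs]] : exists s, [/\ t < s < t + e / 2 / A,
    forall l, s <> ts l & loop_dissipation q v g w s < (e / 2) ^+ 2].
  by near: t; exact: (loop_small H).
have vs : `|v i s c ord0| <= e / 2.
  apply: le_trans (coord_le_enorm _ _) _; rewrite le_enorm ?divr_ge0 ?ltW//.
  apply: le_lt_trans Gs.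
  by have [_ + _] := loop_dissipation_ge H s i i (lt_trans tt0 ts'); apply.
pose dv u := - (k *: v i u + g i u + \sum_j w u i j *: (q i u - q j u)).
have dvA u : t <= u -> `|dv u c ord0| <= A.
  move=> tu; apply: le_trans (coord_le_enorm _ _) _; rewrite enormN.
  have [qB vB] := hBt u tu i; rewrite /A -[leLHS]addr0 lerD//.
  apply: le_trans (enormD _ _) _; apply: lerD.
    apply: le_trans (enormD _ _) _; apply: lerD.
      by rewrite enormZ ger0_norm ?ler_wpM2l//; lra.
    exact: le_trans (loop_force_bound H i u) qB.
  apply: le_trans (enorm_sum _) _.
  rewrite mulr_natl -[in leRHS](card_ord n) -sumr_const; apply: ler_sum => j _.
  have /andP[w0 w1] := loop_weight_bounds H u i j (lt_le_trans tt0 tu).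
  rewrite enormZ ger0_norm// ler_pM ?enorm_ge0//.
  apply: le_trans (enorm_triangle _ y _) _; rewrite lerD// enormB.
  by have [] := hBt u tu j.
have td := loop_dwell_gt0 H; have hd := loop_dwell H.
have step : `|v i s c ord0 - v i t c ord0| <= A * (s - t).
  apply: (@abs_increment_le _ (fun s => v i s c ord0) (fun u => dv u c ord0)
    t0 ts taud) => //; last 1 first.
  - move=> u /andP[tu us] ntu; have tu0 := lt_trans tt0 tu; split.
      exact: is_derive_coord (loop_velocity H i tu0 ntu).
    by apply: dvA; exact: ltW.
  - by move=> u tu; apply: continuous_coord; exact: loop_velocity_continuous H i u tu.
  - exact: ltW.
have sA : A * (s - t) <= e / 2.
  have : A * (e / 2 / A) = e / 2 by rewrite mulrC divfK// gt_eqF.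
  by move=> <-; rewrite ler_pM2l//; lra.
have := ler_distD (v i s c ord0) (v i t c ord0) 0; rewrite !subr0 distrC.
by move=> /le_trans; apply; lra.
Unshelve. all: by end_near. Qed.

Lemma loop_slow {R : realType} {n m : nat} {k hi t0 taud : R} {ts y}
    {q v g : 'I_n -> R -> 'cV[R]_m} {w : R -> 'I_n -> 'I_n -> R} :
  consensus_loop k hi t0 taud ts y q v g w ->
  forall h e : R, 0 < h -> 0 < e -> \forall t \near +oo,
    forall i s, t <= s <= t + h -> enorm (q i s - q i t) <= e.
Proof.
move=> H h e h0 e0.
have m0 : 0 < m%:R + 1 :> R by rewrite ltr_wpDl.
have d0 : 0 < e / (m%:R + 1) / h by rewrite !divr_gt0.
have /near_pinfty_ge hv := loop_velocity_cvg H _ d0.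
near=> t => i s /andP[ts' sth].
have tt0 : t0 < t by near: t; apply: nbhs_pinfty_gt; exact: num_real.
have vt u : t <= u -> forall i c, `|v i u c ord0| <= e / (m%:R + 1) / h.
  by move: u; near: t.
have step c : `|(q i s - q i t) c ord0| <= e / (m%:R + 1).
  rewrite !mxE; apply: (@le_trans _ _ (e / (m%:R + 1) / h * (s - t))).
    apply: (@abs_increment_le _ (fun s => q i s c ord0)
      (fun s => v i s c ord0) t0 ts taud _ _ _ (loop_dwell_gt0 H)
      (loop_dwell H)) => //.
    - move=> u tu; apply: continuous_coord; have [D _] := loop_position H i u tu.
      exact/differentiable_continuous/derivable1_diffP.
    - move=> u /andP[tu us] _; split; last by apply: vt; exact: ltW.
      exact: is_derive_coord (loop_position H i u (lt_trans tt0 tu)).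
  apply: (@le_trans _ _ (e / (m%:R + 1) / h * h)); last by rewrite divfK ?gt_eqF.
  by rewrite ler_pM2l//; lra.
apply: le_trans (enorm_le_coord _ _ step) _.
rewrite mulrCA ler_piMr ?(ltW e0)// ler_pdivrMr// mul1r; lra.
Unshelve. all: by end_near. Qed.

(** The force is small at some time of the window; positions hardly move meanwhile, and the force
    norm is 1-Lipschitz in the position. *)
Lemma loop_force_cvg {R : realType} {n m : nat} {k hi t0 taud : R} {ts y}
    {q v g : 'I_n -> R -> 'cV[R]_m} {w : R -> 'I_n -> 'I_n -> R} :
  consensus_loop k hi t0 taud ts y q v g w ->
  forall e : R, 0 < e -> \forall t \near +oo, forall i, enorm (g i t) <= e.
Proof.
move=> H e e0; have e2 : 0 < e / 2 by rewrite divr_gt0.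
near=> t => i.
have tt0 : t0 < t by near: t; apply: nbhs_pinfty_gt; exact: num_real.
have slow : forall i s, t <= s <= t + 1 -> enorm (q i s - q i t) <= e / 2.
  by near: t; exact: (loop_slow H).
have [s [/andP[ts' st] _ Gs]] : exists s, [/\ t < s < t + 1,
    forall l, s <> ts l & loop_dissipation q v g w s < (e / 2) ^+ 2].
  by near: t; apply: (loop_small H) => //; rewrite exprn_gt0.
have gs : enorm (g i s) <= e / 2.
  rewrite le_enorm ?(ltW e2)//; apply: le_trans (ltW Gs).
  by have [] := loop_dissipation_ge H s i i (lt_trans tt0 ts').
apply: le_trans (loop_force_lip H i t s) _; rewrite [leRHS]splitr lerD//.
by rewrite enormB; apply: slow; rewrite !ltW.
Unshelve. all: by end_near. Qed.

(** Some time [s] within the activity interval of the edge has small dissipation, and the weight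
    there is at least [d], so the two agents are close at [s]. Slow motion carries this back to [t],
    each of three terms costing [e / 3]. *)
Lemma loop_edge {R : realType} {n m : nat} {k hi t0 taud : R} {ts y}
    {q v g : 'I_n -> R -> 'cV[R]_m} {w : R -> 'I_n -> 'I_n -> R} :
  consensus_loop k hi t0 taud ts y q v g w ->
  forall h L d e : R, 0 < h -> 0 < L -> 0 < d -> 0 < e ->
  \forall t \near +oo, forall u i j, t <= u <= t + L ->
    (forall s, u < s < u + h -> d <= w s i j) -> enorm (q i t - q j t) <= e.
Proof.
move=> H h L d e h0 L0 d0 e0.
have e3 : 0 < e / 3 by rewrite divr_gt0.
have c0 : 0 < d * (e / 3) ^+ 2 by rewrite mulr_gt0// exprn_gt0.
have /near_pinfty_ge small := loop_small H h _ h0 c0.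
near=> t => u i j /andP[tu uL] dw.
have tt0 : t0 < t by near: t; apply: nbhs_pinfty_gt; exact: num_real.
have slow : forall i s, t <= s <= t + (L + h) -> enorm (q i s - q i t) <= e / 3.
  by near: t; apply: (loop_slow H) => //; exact: addr_gt0.
have /(_ u tu)[s [/andP[us sh] _ Gs]] : forall r, t <= r ->
    exists s, [/\ r < s < r + h, forall l, s <> ts l &
      loop_dissipation q v g w s < d * (e / 3) ^+ 2].
  by near: t.
have tS := le_lt_trans tu us.
have sE : t <= s <= t + (L + h) by rewrite ltW//=; lra.
have qs : enorm (q i s - q j s) <= e / 3.
  rewrite le_enorm ?(ltW e3)// -(ler_pM2l d0); apply: le_trans (ltW Gs).
  have [_ _] := loop_dissipation_ge H s i j (lt_trans tt0 tS).
  apply: le_trans; rewrite ler_wpM2r ?dot_ge0//.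
  by apply: dw; rewrite us.
have := slow i s sE; have := slow j s sE; rewrite (enormB (q i s)).
have := enorm_triangle (q i t) (q i s) (q j t).
have := enorm_triangle (q i s) (q j s) (q j t).
by lra.
Unshelve. all: by end_near. Qed.

(** * From neighbours to all pairs of agents *)

(** A connecting path can be shortened to one without repeated vertices, which has fewer than [n]
    edges; then the triangle inequality applies along it. *)
Lemma connected_graph_bound {R : realType} {n m : nat}
    (e : 'I_n -> 'I_n -> Prop) (f : 'I_n -> 'cV[R]_m) (d : R) :
  connected_graph e -> 0 <= d -> (forall i j, e i j -> enorm (f i - f j) <= d) ->
  forall i j, enorm (f i - f j) <= n%:R * d.
Proof.
move=> ce d0 he i j; pose r : rel 'I_n := fun a b => `[< e a b \/ e b a >].
have : connect r i j.
  elim: (ce i j) => [a b /asboolP ab|a|a b c _ ab _ bc].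
  - exact: connect1.
  - exact: connect0.
  - exact: connect_trans ab bc.
move=> /connectP[p0 pp ->]; case/shortenP: pp => p pp up _.
have step a b : r a b -> enorm (f a - f b) <= d.
  by move=> /asboolP[/he//|/he]; rewrite enormB.
apply: (@le_trans _ _ ((size p)%:R * d)); last first.
  rewrite ler_wpM2r// ler_nat; apply: ltnW.
  by have := max_card (mem (i :: p)); rewrite (card_uniqP up) card_ord.
elim: p i {up} pp => [|b p IH] a /=.
  by move=> _; rewrite subrr mul0r -(scale0r (f a)) enormZ normr0 mul0r.
move=> /andP[/step ab /IH bp]; rewrite -natr1 mulrDl mul1r [leRHS]addrC.
by apply: le_trans (enorm_triangle _ (f b) _) _; rewrite lerD.
Qed.

Theorem theorem2
  (R : realType) (n m : nat)
  (* Lagrangian dynamics data *)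
  (M : 'I_n -> 'cV[R]_m -> 'M[R]_m)
  (C : 'I_n -> 'cV[R]_m -> 'cV[R]_m -> 'M[R]_m)
  (HM : forall i x, spd (M i x))
  (* constraint sets *)
  (X : 'I_n -> set 'cV[R]_m)
  (HXc : forall i, closed (X i)) (HXv : forall i, cvx_set (X i))
  (HX0ne : exists x, forall i, X i x)
  (HX0b : bounded_eucl [set x | forall i, X i x])
  (* switching graphs *)
  (P : finType) (E : P -> rel 'I_n)
  (HEsym : forall p i j, E p i j = E p j i)
  (t0 : R) (sigma : R -> P) (ts : nat -> R) (taud : R)
  (Htaud : 0 < taud) (Hts0 : ts 0%N = t0)
  (Hdwell : forall l, taud <= ts l.+1 - ts l)
  (Hpc : forall l t, ts l <= t < ts l.+1 -> sigma t = sigma (ts l))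
  (* weights *)
  (a : 'I_n -> 'I_n -> R -> R) (a_lo a_hi : R)
  (Ha_lo : 0 < a_lo) (Ha_hi : 0 < a_hi)
  (Hacont : forall i j, continuous (a i j))
  (Hasym : forall i j t, a i j t = a j i t)
  (Habnd : forall i j t, t0 <= t -> a_lo <= a i j t <= a_hi)
  (* uniform joint connectivity *)
  (T : R) (HT : 0 < T)
  (Hjc : forall t, t0 <= t ->
     connected_graph (fun i j => exists s, t <= s < t + T /\ E (sigma s) i j)) :
  exists k0 : R, forall k : R, 0 < k -> k0 < k ->
  forall (q dq ddq : 'I_n -> R -> 'cV[R]_m),
    (* q i is differentiable on (t0, oo) with derivative dq i,
       dq i is continuous there and differentiable off the switching times *)
    (forall i t, t0 < t -> is_derive t 1 (q i) (dq i t)) ->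
    (forall i t, t0 < t -> {for t, continuous (dq i)}) ->
    (forall i t, t0 < t -> (forall l, t <> ts l) -> is_derive t 1 (dq i) (ddq i t)) ->
    (* closed loop: M_i qdd_i + C_i qd_i = tau_i *)
    (forall i t, t0 < t -> (forall l, t <> ts l) ->
       M i (q i t) *m ddq i t + C i (q i t) (dq i t) *m dq i t =
         C i (q i t) (dq i t) *m dq i t
         - k *: (M i (q i t) *m dq i t)
         - M i (q i t) *m (q i t - eproj (X i) (q i t))
         - M i (q i t) *m (\sum_(j < n | E (sigma t) i j) a i j t *: (q i t - q j t))) ->
    (forall i, edist_set [set x | forall i, X i x] (q i t) @[t --> +oo] --> 0) /\
    (forall i j, (q i t - q j t) @[t --> +oo] --> (0 : 'cV[R]_m)) /\
    (forall i, dq i t @[t --> +oo] --> (0 : 'cV[R]_m)).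
Proof.
have [y Xy] := HX0ne.
have projP i x : is_eproj (X i) x (eproj (X i) x).
  by apply: eprojP => //; exists y.
(* This threshold dominates both gain conditions, [3] and [2 * n%:R * a_hi + 2]. *)
exists (2 * n%:R * a_hi + 3) => k k0 kk0 q dq ddq Dq dqc Ddq dyn.
pose g i t := q i t - eproj (X i) (q i t).
pose w t i j := if E (sigma t) i j then a i j t else 0.
have nhi0 : 0 <= 2 * n%:R * a_hi by rewrite !mulr_ge0// ltW.
have H : consensus_loop k a_hi t0 taud ts y q dq g w.
  split=> //.
  - move=> i t tt0 nts; have := Ddq i t tt0 nts; congr (is_derive _ _ _ _).
    (* It suffices to compare accelerations after multiplying by the inertia matrix and adding the
       Coriolis term, which is the form of [dyn]. *)
    apply: (spd_inj _ (HM i (q i t))) => /=.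
    apply: (addIr (C i (q i t) (dq i t) *m dq i t)); rewrite dyn//.
    have -> : \sum_(j < n | E (sigma t) i j) a i j t *: (q i t - q j t) =
        \sum_j w t i j *: (q i t - q j t).
      rewrite big_mkcond; apply: eq_bigr => j _.
      by rewrite /w; case: ifP => // _; rewrite scale0r.
    rewrite mulmxN !mulmxDr -scalemxAr -/(g i t) !opprD [RHS]addrC.
    by rewrite -!addrA.
  - by move=> i t; apply: eproj_monotone (projP i _) _.
  - by move=> i s t; apply: enorm_eproj_lip (projP i _) (projP i _).
  - by move=> t i j; rewrite /w HEsym Hasym.
  - move=> t i j tt0; rewrite /w; case: ifP => _; last by rewrite lexx ltW.
    have /andP[lo ->] := Habnd i j t (ltW tt0).
    by rewrite (le_trans _ lo)// ltW.
  - exact: ltW.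
  - lra.
  - lra.
have agree e : 0 < e -> \forall t \near +oo, forall i j,
    enorm (q i t - q j t) <= e.
  move=> e0; pose h := taud / 2; have h0 : 0 < h by rewrite divr_gt0.
  have n0 : 0 < n%:R + 1 :> R by rewrite ltr_wpDl.
  have d0 : 0 < e / (n%:R + 1) by rewrite divr_gt0.
  have L0 : 0 < h + T by rewrite addr_gt0.
  near=> t => i j.
  have tt0 : t0 < t by near: t; apply: nbhs_pinfty_gt; exact: num_real.
  have edge : forall u i j, t <= u <= t + (h + T) ->
      (forall s, u < s < u + h -> a_lo <= w s i j) ->
      enorm (q i t - q j t) <= e / (n%:R + 1).
    by near: t; exact: loop_edge H h _ _ _ h0 L0 Ha_lo d0.
  apply: (@le_trans _ _ (n%:R * (e / (n%:R + 1)))); last first.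
    rewrite mulrCA ler_piMr ?(ltW e0)// ler_pdivrMr// mul1r; lra.
  (* Connectivity is used on the window starting at [t + h], so that an interval of length [h]
     ending at an activation time [s] still begins no earlier than [t]. *)
  have tht0 : t0 <= t + h by lra.
  apply: (connected_graph_bound _ (q ^~ t) _ (Hjc _ tht0)); first exact: ltW.
  move=> {}i {}j [s [/andP[ths sT] Eij]].
  have st0 : ts 0%N <= s by rewrite Hts0; lra.
  have [l /andP[ls sl]] := dwell_interval Htaud Hdwell st0.
  have active u : ts l <= u -> u + h <= ts l.+1 -> t <= u ->
      forall r, u < r < u + h -> a_lo <= w r i j.
    move=> lu ul tu r /andP[ur rh]; rewrite /w.
    have -> : sigma r = sigma s.
      by rewrite (Hpc l s) ?ls// (Hpc l r)//; apply/andP; split; lra.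
    rewrite Eij; have tr : t0 <= r by lra.
    by case/andP: (Habnd i j r tr).
  have dl := Hdwell l; have h2 : h + h = taud by rewrite /h -splitr.
  (* The dwell interval around [s] has length at least [2 h], so the edge is
     active for a time [h] right after or right before [s]. *)
  have [sh|sh] := leP (s + h) (ts l.+1).
    by apply: (edge s); [apply/andP; split; lra|apply: active => //; lra].
  apply: (edge (s - h)); first by apply/andP; split; lra.
  by apply: active; lra.
have force e : 0 < e -> \forall t \near +oo, forall i, enorm (g i t) <= e.
  exact: loop_force_cvg H e.
have [B B0 bound] := loop_bounded H.
split; [|split].
- move=> i; apply/cvgrPdist_le => e e0.
  (* [B + enorm y] bounds the coordinates of every late position, which confines the positions to a
     compact box. *)
  have [d d0 hd] := edist_bigcap_small X (B + enorm y) e HXc e0.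
  have d2 : 0 < d / 2 by rewrite divr_gt0.
  near=> t.
  rewrite sub0r normrN ger0_norm; last first.
    by apply: edist_set_ge0; exists y.
  apply: hd => [c|j].
    apply: le_trans (coord_le_enorm _ _) _.
    have := enormD (q i t - y) y; rewrite subrK => /le_trans; apply.
    rewrite lerD2r; suff /(_ i)[] : forall i,
      enorm (q i t - y) <= B /\ enorm (dq i t) <= B by [].
    by near: t.
  (* Agent [i] is near agent [j] by agreement, and agent [j] is near [X j] because its force is
     small; each costs [d / 2]. *)
  exists (eproj (X j) (q j t)); first by case: (projP j (q j t)).
  apply: le_trans (enorm_triangle _ (q j t) _) _; rewrite [leRHS]splitr lerD//.
    by move: (i) (j); near: t; exact: agree.
  by move: (j); near: t; exact: force.
- move=> i j; apply/cvgrPdist_le => e e0; near=> t.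
  rewrite sub0r normrN; apply: le_trans (norm_le_enorm _) _.
  by move: (i) (j); near: t; exact: agree.
- move=> i; apply/cvgrPdist_le => e e0; near=> t.
  rewrite sub0r normrN; apply: (mx_norm_le_coord _ _ (ltW e0)).2.
  by move: (i); near: t; exact: loop_velocity_cvg H e e0.
Unshelve. all: by end_near. Qed.
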